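(* Let $\mathrm{ZX}_{\mathsf{simp}}$ be the simplified stabilizer ZX-calculus described in the context. The colour change rule (H), i.e. the family of equations $$H^{\otimes m}\circ R_X^{(n,m)}(\alpha)\circ H^{\otimes n}=R_Z^{(n,m)}(\alpha)\qquad(n,m\ge0,\ \alpha\in\tfrac\pi2\mathbb Z),$$ is necessary: $\mathrm{ZX}_{\mathsf{simp}}\setminus(\mathrm{H})\not\vdash(\mathrm{H})$. That is, when the whole family (H) is removed, at least one of its instances is not derivable from the remaining rules.
   Context: **Diagrams.** Diagrams $D:n\to m$ ($n,m\in\mathbb N$) are the morphisms of the free strict monoidal category with objects $\mathbb N$ (tensor on objects is addition) generated by: green spiders $R_Z^{(n,m)}(\alpha):n\to m$ and red spiders $R_X^{(n,m)}(\alpha):n\to m$ for all $n,m\in\mathbb N$ and $\alpha\in\{k\pi/2\mid k\in\mathbb Z\}$ (angles are real numbers, not taken modulo $2\pi$); $H:1\to1$; the swap $\sigma:2\to2$; the cup $\epsilon:2\to0$; the cap $\eta:0\to2$. The identity on $n$ is $1_n$, and $e=1_0$ is the empty diagram. $D_2\circ D_1$ means first $D_1$ then $D_2$; in $D_1\otimes D_2$, $D_1$ is on the left. Put $R_Z^{(n,m)}:=R_Z^{(n,m)}(0)$, $R_X^{(n,m)}:=R_X^{(n,m)}(0)$. **Only connectivity matters (meta rule).** $G_D=(V,E,\ell)$ has one vertex for each spider, each $H$, each input and each output of $D$, and one edge for each wire of $D$ (wires being followed through swaps, cups and caps), joining the vertices at its two ends. A green (red) spider of angle $\alpha$ is labelled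 $R_Z(\alpha)$ ($R_X(\alpha)$), an $H$ is labelled $H$, the $j$-th input (output) from the left is labelled $I_j$ ($O_j$). The order and direction in which wires are attached to a spider or $H$ is not recorded. The meta rule: $D_1=D_2$ whenever there is a bijection of the vertices of $G_{D_1}$ and $G_{D_2}$ preserving labels and the number of edges between any two (possibly equal) vertices, and the two diagrams have the same number of closed wire loops carrying no vertex. **Calculus.** For a set $R$ of rules, $R\vdash D_1=D_2$ means that $(D_1,D_2)$ belongs to the smallest equivalence relation on parallel diagrams that is closed under $\circ$ and $\otimes$ and contains all equations in $R$. $\mathrm{ZX}_{\mathsf{simp}}$ consists of the meta rule above and of the following rules; $\mathrm{ZX}_{\mathsf{simp}}\setminus(\mathrm X)$ is obtained by deleting all instances of rule (X). - (S1) for all $a,b,c,d\ge0$, $k\ge1$ and all $\alpha,\beta$: $(1_b\otimes R_Z^{(k+c,d)}(\beta))\circ(R_Z^{(a,b+k)}(\alpha)\otimes1_c)=R_Z^{(a+c,b+d)}(\alpha+\beta)$ (ordinary addition of angles). - (S3$'$L) $\eta=R_Z^{(0,2)}$; (S3$'$R) $R_Z^{(0,2)}=R_X^{(0,2)}$. - (B1) $(R_Z^{(1,0)}\circ R_X^{(0,1)})\otimes(R_Z^{(1,2)}\circ R_X^{(0,1)})=R_X^{(0,1)}\otimes R_X^{(0,1)}$. - (B2$'$) $R_Z^{(0,0)}\otimes\big[(R_X^{(2,1)}\otimes R_X^{(2,1)})\circ(1_1\otimes\sigma\otimes1_1)\circ(R_Z^{(1,2)}\otimes R_Z^{(1,2)})\big]=(R_Z^{(1,0)}\circ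 R_X^{(0,1)})\otimes(R_Z^{(1,2)}\circ R_X^{(2,1)})$. - (EU$'$) $H=R_Z^{(1,1)}(\tfrac\pi2)\circ R_X^{(2,1)}\circ(R_Z^{(0,1)}(-\tfrac\pi2)\otimes1_1)\circ R_Z^{(1,1)}(\tfrac\pi2)$. - (H) for all $n,m,\alpha$: $H^{\otimes m}\circ R_X^{(n,m)}(\alpha)\circ H^{\otimes n}=R_Z^{(n,m)}(\alpha)$. - (IV$'$) $R_Z^{(0,0)}\otimes(R_X^{(3,0)}\circ R_Z^{(0,3)})\otimes(R_X^{(3,0)}\circ R_Z^{(0,3)})=e$. - (ZO$'$) $R_Z^{(0,0)}(\pi)\otimes R_Z^{(0,1)}=R_Z^{(0,0)}(\pi)\otimes R_X^{(0,1)}$. *)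

(* Defs.v *)
From mathcomp Require Import all_boot all_order all_algebra.

Set Implicit Arguments.
Unset Strict Implicit.
Unset Printing Implicit Defensive.

(** * Diagrams *)

(* An angle alpha in {k * pi/2 | k an integer} is represented by the integer k.
   Since k |-> k * pi/2 is injective and additive, this is faithful to angles
   that are real numbers, added as such and not reduced modulo 2 * pi. *)
Notation angle := int.
Notation half_pi := (1%Z : angle).
Notation minus_half_pi := ((-1)%Z : angle).
Notation pi := (2%Z : angle).

(* Terms for the morphisms of the free strict monoidal category; the category
   itself is the quotient of these terms by the congruence generated by
   [strict_monoidal] below, which is built into derivability. *)
Inductive diagram : nat -> nat -> Type :=
| Z (n m : nat) (a : angle) : diagram n m
| X (n m : nat) (a : angle) : diagram n m
| Had : diagram 1 1
| Swap : diagram 2 2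
| Cup : diagram 2 0
| Cap : diagram 0 2
| Id (n : nat) : diagram n n
| Comp (n m p : nat) (D2 : diagram m p) (D1 : diagram n m) : diagram n p
| Tens (n1 m1 n2 m2 : nat) (D1 : diagram n1 m1) (D2 : diagram n2 m2) :
    diagram (n1 + n2) (m1 + m2).

Declare Scope diagram_scope.
Delimit Scope diagram_scope with D.
Bind Scope diagram_scope with diagram.
Open Scope diagram_scope.

Notation "D2 ∘ D1" := (Comp D2 D1) (at level 50, left associativity)
  : diagram_scope.
Notation "D1 ⊗ D2" := (Tens D1 D2) (at level 45, left associativity)
  : diagram_scope.
Notation Z0 n m := (Z n m 0%Z).
Notation X0 n m := (X n m 0%Z).
Notation empty := (Id 0).

Definition cast_diagram n m n' m' (en : n = n') (em : m = m')
    (D : diagram n m) : diagram n' m' :=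
  ecast k (diagram n' k) em (ecast k (diagram k m) en D).

Fixpoint Had_pow (n : nat) : diagram n n :=
  if n is n'.+1 then Had ⊗ Had_pow n' else empty.

Inductive strict_monoidal : forall n m, diagram n m -> diagram n m -> Prop :=
| Comp_assoc n m p q (D3 : diagram p q) (D2 : diagram m p) (D1 : diagram n m) :
    strict_monoidal (D3 ∘ D2 ∘ D1) (D3 ∘ (D2 ∘ D1))
| Comp_idl n m (D : diagram n m) : strict_monoidal (Id m ∘ D) D
| Comp_idr n m (D : diagram n m) : strict_monoidal (D ∘ Id n) D
| Tens_assoc n1 m1 n2 m2 n3 m3
    (D1 : diagram n1 m1) (D2 : diagram n2 m2) (D3 : diagram n3 m3) :
    strict_monoidal
      (cast_diagram (addnA n1 n2 n3) (addnA m1 m2 m3) (D1 ⊗ (D2 ⊗ D3)))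
      (D1 ⊗ D2 ⊗ D3)
| Tens_idl n m (D : diagram n m) : strict_monoidal (n := n) (empty ⊗ D) D
| Tens_idr n m (D : diagram n m) :
    strict_monoidal (cast_diagram (addn0 n) (addn0 m) (D ⊗ empty)) D
| Tens_id n m : strict_monoidal (Id n ⊗ Id m) (Id (n + m))
| Tens_comp n1 m1 p1 n2 m2 p2
    (D2 : diagram m1 p1) (D1 : diagram n1 m1)
    (E2 : diagram m2 p2) (E1 : diagram n2 m2) :
    strict_monoidal ((D2 ∘ D1) ⊗ (E2 ∘ E1)) ((D2 ⊗ E2) ∘ (D1 ⊗ E1)).

(** * The labelled multigraph of a diagram *)

Inductive label : Type :=
| LZ of angle
| LX of angle
| LH
| LIn of nat
| LOut of nat.

(* A diagram is first read as a collection of wire segments, some of which end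
   at internal vertices (spiders and H's), lie at inputs or outputs, or are
   glued to each other.  A wire is a connected component of glued segments. *)
Record wiring (n m : nat) := Wiring {
  vert : finType;
  vlab : vert -> label;
  seg : finType;
  inp : 'I_n -> seg;
  out : 'I_m -> seg;
  att : seg -> pred vert;
  glue : rel seg
}.

Definition void_lab (v : void) : label := match v with end.

Definition vertex_wiring n m (l : label) : wiring n m :=
  @Wiring n m unit (fun=> l) ('I_n + 'I_m)%type inl inr
    (fun _ _ => true) (fun _ _ => false).

Definition plain_wiring n m (S : finType) (i : 'I_n -> S) (o : 'I_m -> S) :
    wiring n m :=
  @Wiring n m void void_lab S i o (fun _ _ => false) (fun _ _ => false).

Definition sum_lab (A B : Type) (f : A -> label) (g : B -> label) (v : A + B) :=
  match v with inl x => f x | inr y => g y end.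

Definition sum_att (S1 S2 V1 V2 : Type) (a1 : S1 -> pred V1)
    (a2 : S2 -> pred V2) (s : S1 + S2) (v : V1 + V2) : bool :=
  match s, v with
  | inl s1, inl v1 => a1 s1 v1
  | inr s2, inr v2 => a2 s2 v2
  | _, _ => false
  end.

Definition comp_wiring n m p (G2 : wiring m p) (G1 : wiring n m) :
    wiring n p :=
  @Wiring n p (vert G1 + vert G2)%type (sum_lab (@vlab _ _ G1) (@vlab _ _ G2))
    (seg G1 + seg G2)%type
    (fun i => inl (inp G1 i)) (fun k => inr (out G2 k))
    (sum_att (@att _ _ G1) (@att _ _ G2))
    (fun s t => match s, t with
      | inl s1, inl t1 => glue s1 t1
      | inr s2, inr t2 => glue s2 t2
      | inl s1, inr t2 => [exists j, (out G1 j == s1) && (inp G2 j == t2)]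
      | inr _, inl _ => false
      end).

Definition tens_wiring n1 m1 n2 m2 (G1 : wiring n1 m1) (G2 : wiring n2 m2) :
    wiring (n1 + n2) (m1 + m2) :=
  @Wiring (n1 + n2) (m1 + m2)
    (vert G1 + vert G2)%type (sum_lab (@vlab _ _ G1) (@vlab _ _ G2))
    (seg G1 + seg G2)%type
    (fun i => match split i with
      | inl i1 => inl (inp G1 i1) | inr i2 => inr (inp G2 i2) end)
    (fun j => match split j with
      | inl j1 => inl (out G1 j1) | inr j2 => inr (out G2 j2) end)
    (sum_att (@att _ _ G1) (@att _ _ G2))
    (fun s t => match s, t with
      | inl s1, inl t1 => glue s1 t1
      | inr s2, inr t2 => glue s2 t2
      | _, _ => false
      end).

Fixpoint wiring_of n m (D : diagram n m) : wiring n m :=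
  match D with
  | Z n m a => vertex_wiring n m (LZ a)
  | X n m a => vertex_wiring n m (LX a)
  | Had => vertex_wiring 1 1 LH
  | Swap => plain_wiring (fun i : 'I_2 => i) (fun j : 'I_2 => rev_ord j)
  | Cup => plain_wiring (fun _ : 'I_2 => tt) (fun j : 'I_0 => tt)
  | Cap => plain_wiring (fun i : 'I_0 => tt) (fun _ : 'I_2 => tt)
  | Id n => plain_wiring (fun i : 'I_n => i) (fun j : 'I_n => j)
  | Comp _ _ _ D2 D1 => comp_wiring (wiring_of D2) (wiring_of D1)
  | Tens _ _ _ _ D1 D2 => tens_wiring (wiring_of D1) (wiring_of D2)
  end.

Section Graph.
Variables (n m : nat) (D : diagram n m).
Let W := wiring_of D.

Definition vertex : finType := ('I_n + 'I_m + vert W)%type.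

(* Inputs and outputs are numbered from 0. *)
Definition vertex_label (v : vertex) : label :=
  match v with
  | inl (inl i) => LIn i
  | inl (inr j) => LOut j
  | inr x => vlab x
  end.

Definition ends_at (s : seg W) (v : vertex) : bool :=
  match v with
  | inl (inl i) => inp W i == s
  | inl (inr j) => out W j == s
  | inr x => att s x
  end.

Definition wire_through (s : seg W) : {set seg W} :=
  [set t | connect [rel x y | glue x y || glue y x] s t].

Definition wires : {set {set seg W}} := [set wire_through s | s : seg W].

Definition wire_ends (w : {set seg W}) : {set vertex} :=
  [set v | [exists s in w, ends_at s v]].

(* A wire is either a closed loop or has exactly two ends, so its set of end
   vertices is empty, a singleton (both ends at one vertex: a self-loop) or a
   pair; [set u; v] with u = v counts self-loops. *)
Definition num_edges (u v : vertex) : nat :=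
  #|[set w in wires | wire_ends w == [set u; v]]|.

Definition num_loops : nat := #|[set w in wires | wire_ends w == set0]|.

End Graph.

Definition same_connectivity n m (D1 D2 : diagram n m) : Prop :=
  (exists f : vertex D1 -> vertex D2,
    [/\ bijective f,
        forall v, vertex_label (f v) = vertex_label v
      & forall u v, num_edges (f u) (f v) = num_edges u v]) /\
  num_loops D1 = num_loops D2.

(** * The calculus *)

Definition rules := forall n m, diagram n m -> diagram n m -> Prop.

Inductive derivable (R : rules) :
    forall n m, diagram n m -> diagram n m -> Prop :=
| derivable_rule n m (D1 D2 : diagram n m) :
    R n m D1 D2 -> derivable R D1 D2
| derivable_strict n m (D1 D2 : diagram n m) :
    strict_monoidal D1 D2 -> derivable R D1 D2
| derivable_refl n m (D : diagram n m) : derivable R D D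
| derivable_sym n m (D1 D2 : diagram n m) :
    derivable R D1 D2 -> derivable R D2 D1
| derivable_trans n m (D1 D2 D3 : diagram n m) :
    derivable R D1 D2 -> derivable R D2 D3 -> derivable R D1 D3
| derivable_comp n m p (D2 E2 : diagram m p) (D1 E1 : diagram n m) :
    derivable R D2 E2 -> derivable R D1 E1 ->
    derivable R (D2 ∘ D1) (E2 ∘ E1)
| derivable_tens n1 m1 n2 m2
    (D1 E1 : diagram n1 m1) (D2 E2 : diagram n2 m2) :
    derivable R D1 E1 -> derivable R D2 E2 ->
    derivable R (D1 ⊗ D2) (E1 ⊗ E2).

Inductive rule_name :=
  rule_meta | rule_S1 | rule_S3L | rule_S3R | rule_B1 | rule_B2 | rule_EU
| rule_H | rule_IV | rule_ZO.

Inductive instance : rule_name -> rules :=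
| instance_meta n m (D1 D2 : diagram n m) :
    same_connectivity D1 D2 -> instance rule_meta D1 D2
| instance_S1 (a b c d k : nat) (alpha beta : angle) :
    1 <= k ->
    instance rule_S1
      ((Id b ⊗ Z (k + c) d beta)
         ∘ cast_diagram erefl (esym (addnA b k c)) (Z a (b + k) alpha ⊗ Id c))
      (Z (a + c) (b + d) (alpha + beta)%R)
| instance_S3L : instance rule_S3L Cap (Z0 0 2)
| instance_S3R : instance rule_S3R (Z0 0 2) (X0 0 2)
| instance_B1 :
    instance rule_B1
      ((Z0 1 0 ∘ X0 0 1) ⊗ (Z0 1 2 ∘ X0 0 1))
      (X0 0 1 ⊗ X0 0 1)
| instance_B2 :
    instance rule_B2
      (Z0 0 0 ⊗ ((X0 2 1 ⊗ X0 2 1) ∘ (Id 1 ⊗ Swap ⊗ Id 1) ∘ (Z0 1 2 ⊗ Z0 1 2)))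
      ((Z0 1 0 ∘ X0 0 1) ⊗ (Z0 1 2 ∘ X0 2 1))
| instance_EU :
    instance rule_EU
      Had
      (Z 1 1 half_pi ∘ X0 2 1 ∘ (Z 0 1 minus_half_pi ⊗ Id 1) ∘ Z 1 1 half_pi)
| instance_H (n m : nat) (alpha : angle) :
    instance rule_H (Had_pow m ∘ X n m alpha ∘ Had_pow n) (Z n m alpha)
| instance_IV :
    instance rule_IV (Z0 0 0 ⊗ (X0 3 0 ∘ Z0 0 3) ⊗ (X0 3 0 ∘ Z0 0 3)) empty
| instance_ZO : instance rule_ZO (Z 0 0 pi ⊗ Z0 0 1) (Z 0 0 pi ⊗ X0 0 1).

Definition ZX_simp : rules := fun n m D1 D2 => exists r, @instance r n m D1 D2.

Definition ZX_simp_without (r0 : rule_name) : rules :=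
  fun n m D1 D2 => exists r, r <> r0 /\ @instance r n m D1 D2.

(* Main.v *)
Require Import Defs.
From mathcomp Require Import all_boot all_order all_algebra.

(** Colour change is the only rule, apart from the meta rule, whose instances
    contain red spiders of nonzero angle, and the meta rule preserves vertex
    labels.  Without colour change, whether a diagram contains a red spider of
    nonzero angle is therefore invariant, but [X 0 0 1] contains one while
    [Z 0 0 1] does not. *)

Fixpoint has_phased_red n m (D : diagram n m) : bool :=
  match D with
  | X _ _ a => a != 0%R
  | Comp _ _ _ D2 D1 => has_phased_red _ _ D1 || has_phased_red _ _ D2
  | Tens _ _ _ _ D1 D2 => has_phased_red _ _ D1 || has_phased_red _ _ D2
  | _ => false
  end.
Arguments has_phased_red {n m} D.

Definition phased_red_label (l : label) : bool :=
  if l is LX a then a != 0%R else false.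

Lemma exists_sum_lab (A B : finType) (f : A -> label) (g : B -> label)
    (p : pred label) :
  [exists v, p (sum_lab f g v)] = [exists x, p (f x)] || [exists y, p (g y)].
Proof.
apply/existsP/orP => [[[x|y] pv]|[/existsP[x px]|/existsP[y py]]].
- by left; apply/existsP; exists x.
- by right; apply/existsP; exists y.
- by exists (inl x).
- by exists (inr y).
Qed.

(** This turns the syntactic flag into a property of vertex labels, which the bijection of the meta
    rule preserves. Input and output vertices are never red, so only internal ones count. *)
Lemma has_phased_redE n m (D : diagram n m) :
  has_phased_red D = [exists v : vertex D, phased_red_label (vertex_label v)].
Proof.
transitivity [exists x : vert (wiring_of D), phased_red_label (vlab x)].
  elim: D => {n m} [n m a|n m a|||||n|n m p D2 IH2 D1 IH1|
      n1 m1 n2 m2 D1 IH1 D2 IH2] /=.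
  (* A generator has at most one internal vertex; only a phased red spider needs a witness. *)
  1-7: by apply/idP/existsP => [|[[]]] //; exists tt.
  - by rewrite exists_sum_lab IH1 IH2.
  - by rewrite exists_sum_lab IH1 IH2.
apply/existsP/existsP => [[x px]|[[[i|j]|x] px]] //.
- by exists (inr x).
- by exists x.
Qed.

Lemma same_connectivity_has_phased_red n m (D1 D2 : diagram n m) :
  same_connectivity D1 D2 -> has_phased_red D1 = has_phased_red D2.
Proof.
move=> [[f [[g _ fK] lab_f _]] _]; rewrite !has_phased_redE.
apply/existsP/existsP => [[v pv]|[v pv]].
- by exists (f v); rewrite lab_f.
- by exists (g v); rewrite -lab_f fK.
Qed.

Lemma has_phased_red_cast n m n' m' (en : n = n') (em : m = m')
    (D : diagram n m) :
  has_phased_red (cast_diagram en em D) = has_phased_red D.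
Proof. by case: n' / en; case: m' / em. Qed.

Lemma strict_monoidal_has_phased_red n m (D1 D2 : diagram n m) :
  strict_monoidal D1 D2 -> has_phased_red D1 = has_phased_red D2.
Proof.
case=> *; rewrite ?has_phased_red_cast /= ?orbF ?orbA //.
(* The interchange law remains: it swaps the two middle disjuncts. *)
by rewrite -!orbA; congr (_ || _); rewrite orbCA.
Qed.

Lemma instance_has_phased_red r n m (D1 D2 : diagram n m) :
  r <> rule_H -> instance r D1 D2 -> has_phased_red D1 = has_phased_red D2.
Proof.
(* In each fixed rule any red spider has angle [0], so both flags compute to [false]. The meta rule
   and (S1), whose cast blocks computation, remain. *)
move=> + rD; case: rD => //.
- by move=> *; apply: same_connectivity_has_phased_red.
- by move=> * /=; rewrite has_phased_red_cast.
Qed.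

Lemma derivable_has_phased_red n m (D1 D2 : diagram n m) :
  derivable (ZX_simp_without rule_H) D1 D2 ->
  has_phased_red D1 = has_phased_red D2.
Proof.
elim=> {n m D1 D2} //= [n m D1 D2 [r [rH rD]]|n m D1 D2|n m D1 D2 D3 _ -> //|
    n m p D2 E2 D1 E1 _ -> _ -> //|n1 m1 n2 m2 D1 E1 D2 E2 _ -> _ -> //].
- exact: instance_has_phased_red rH rD.
- exact: strict_monoidal_has_phased_red.
Qed.

Theorem lemma3p5 :
  exists (n m : nat) (alpha : angle),
    ~ derivable (ZX_simp_without rule_H)
        (Had_pow m ∘ X n m alpha ∘ Had_pow n) (Z n m alpha).
(* Without legs both powers of [Had] are [empty], and the flags compute to [true] and [false]. *)
Proof. by exists 0, 0, half_pi => /derivable_has_phased_red. Qed.
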